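(* Let $n\ge 1$ and let $A\subset\mathbb{R}^n$ be an unbounded set. Then the following two conditions are quantitatively equivalent: (1) $A$ has the $c$-isometric approximation property ($c$-IAP). (2) $\mu(A)\ge 1/c'$. More precisely: if $c>0$ and $A$ has the $c$-IAP, then $\mu(A)\ge 1/(17c)$; and if $c'>0$ and $\mu(A)\ge 1/c'$, then $A$ has the $\sqrt2\,c'$-IAP. Moreover, the constant $\sqrt 2$ is the best possible: it cannot be replaced by any smaller universal constant, i.e. for every $\kappa<\sqrt 2$ it is not true that, for all $n\ge1$, all unbounded $A\subset\mathbb{R}^n$ and all $c'>0$, the condition $\mu(A)\ge 1/c'$ implies that $A$ has the $\kappa c'$-IAP.
   Context: $|\cdot|$ is the Euclidean norm and $x\cdot y$ the inner product. For $\varepsilon\ge0$, a map $f\colon A\to\mathbb{R}^n$ is an $\varepsilon$-nearisometry if $|x-y|-\varepsilon\le|f(x)-f(y)|\le|x-y|+\varepsilon$ for all $x,y\in A$. An isometry is a distance-preserving map. For $c>0$, a set $A\subset\mathbb{R}^n$ has the $c$-isometric approximation property ($c$-IAP) if for each $\varepsilon\ge0$ and each $\varepsilon$-nearisometry $f\colon A\to\mathbb{R}^n$ there is an isometry $T\colon\mathbb{R}^n\to\mathbb{R}^n$ such that $\sup\{|T(x)-f(x)|:x\in A\}\le c\varepsilon$. For an unbounded set $A$, a unit vector $u$ is a cluster direction of $A$ if there is a sequence $(x_j)$ in $A$ with $|x_j|\to\infty$ and $x_j/|x_j|\to u$. The set of all cluster directions of $A$ is denoted $\mathrm{cd}\,A$.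 For a subset $X$ of the unit sphere and a unit vector $e$, set $\sigma(e,X)=\sup\{|u\cdot e|:u\in X\}$ and $\mu_1(X)=\inf\{\sigma(e,X):|e|=1\}$, with $\mu_1(\emptyset)=0$. For an unbounded set $A$ set $\mu(A)=\mu_1(\mathrm{cd}\,A)$. *)

(* Defs.v *)
From mathcomp Require Export all_boot all_order all_algebra.
From mathcomp Require Export all_classical all_reals all_analysis.

Set Implicit Arguments.
Unset Strict Implicit.
Unset Printing Implicit Defensive.

Export Order.TTheory GRing.Theory Num.Theory.
Export numFieldNormedType.Exports.

Local Open Scope classical_set_scope.
Local Open Scope ring_scope.

(* The library norm `|x| on 'rV[R]_n is the sup norm, hence the explicit
   Euclidean structure below. *)
Definition dot (R : realType) (n : nat) (x y : 'rV[R]_n) : R :=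
  \sum_(i < n) x 0 i * y 0 i.

Definition enorm (R : realType) (n : nat) (x : 'rV[R]_n) : R :=
  Num.sqrt (dot x x).

(* A map A -> R^n is represented by a total function, of which only the values
   on A are used. *)
Definition nearisometry (R : realType) (n : nat) (A : set 'rV[R]_n) (eps : R)
    (f : 'rV[R]_n -> 'rV[R]_n) : Prop :=
  forall x y, A x -> A y ->
    enorm (x - y) - eps <= enorm (f x - f y) /\
    enorm (f x - f y) <= enorm (x - y) + eps.

Definition isometry (R : realType) (n : nat)
    (T : 'rV[R]_n -> 'rV[R]_n) : Prop :=
  forall x y, enorm (T x - T y) = enorm (x - y).

(* The supremum is taken in \bar R: the real-valued sup of a set that is not
   bounded above is 0. *)
Definition IAP (R : realType) (n : nat) (c : R) (A : set 'rV[R]_n) : Prop :=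
  forall (eps : R) (f : 'rV[R]_n -> 'rV[R]_n),
    0 <= eps -> nearisometry A eps f ->
    exists2 T : 'rV[R]_n -> 'rV[R]_n, isometry T &
      (ereal_sup [set (enorm (T x - f x))%:E | x in A] <= (c * eps)%:E)%E.

Definition unbounded (R : realType) (n : nat) (A : set 'rV[R]_n) : Prop :=
  ~ exists M : R, forall x, A x -> enorm x <= M.

Definition cluster_directions (R : realType) (n : nat) (A : set 'rV[R]_n) :
    set 'rV[R]_n :=
  [set u | enorm u = 1 /\
    exists x : nat -> 'rV[R]_n,
      [/\ forall j, A (x j),
          enorm (x j) @[j --> \oo] --> +oo &
          enorm ((enorm (x j))^-1 *: x j - u) @[j --> \oo] --> (0 : R)]].

(* For X in the unit sphere, e a unit vector and n >= 1, the sets below are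
   bounded, and nonempty when X is, so the real-valued sup and inf are the
   true ones. *)
Definition sigma (R : realType) (n : nat) (e : 'rV[R]_n) (X : set 'rV[R]_n) :
    R :=
  sup [set `|dot u e| | u in X].

Definition mu1 (R : realType) (n : nat) (X : set 'rV[R]_n) : R :=
  if X == set0 then 0
  else inf [set sigma e X | e in [set e : 'rV[R]_n | enorm e = 1]].

Definition mu (R : realType) (n : nat) (A : set 'rV[R]_n) : R :=
  mu1 (cluster_directions A).

(* Main.v *)
Require Import Defs.
From mathcomp Require Import zify ring lra.

Set Implicit Arguments.
Unset Strict Implicit.
Unset Printing Implicit Defensive.

Local Open Scope classical_set_scope.
Local Open Scope ring_scope.

(** Both implications compare a nearisometry with the directions in which the
    set goes to infinity.

    _From [mu] to isometric approximation._  Let [f] be an [eps]-nearisometry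
    of [A].  Along points [y] of [A] going to infinity in a cluster direction
    [u], the images go to infinity in a direction [u'], and comparing the
    distances from [x] to [y] and from [f x] to [f y] gives
    [|f x . u' - x . u - t| <= eps] on [A], with a constant [t]
    ([nearisometry_at_infinity]).  Letting [x] itself go to infinity shows that
    [u |-> u'] preserves inner products; as [mu A > 0], cluster directions
    span, so [u' = u *m Q] for an orthogonal [Q] ([orthogonal_extension]).  The
    set of all [f x - x *m Q] thus has width at most [2 * eps] in each of the
    directions [u'], hence diameter at most [2 * c' * eps], and the
    dimension-free form of Jung's theorem ([jung]) puts it in a ball of radius
    [sqrt 2 * c' * eps], whose centre is the translation part of the isometry.

    _From isometric approximation to [mu]._  If [mu A < 1 / (17 * c)], a unit
    vector [e] is almost orthogonal to all far points of [A].  Then the map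
    [x + (t * h |x|) *: e], where [h] increases from [0] to [1] so slowly that
    points of comparable norms are displaced by almost the same vector, is an
    [eps]-nearisometry with [eps] small compared to [t]
    ([slow_translation_nearisometry]).  An isometry within [c * eps] of it would
    give an affine function approximating [t * h |x|] on [A] whose linear part
    is bounded on [A], with a bound independent of [t]
    ([uniform_functional_bound]), which is impossible for large [t].

    _Optimality._  Jung's constant is approached by regular simplices of high
    dimension.  For points of [A] whose norms grow fast, only the component of
    the displacements along the direction of the farther of two points matters
    ([sparse_perturbation]); displacing each point by the midpoint of two
    vertices of the simplex that are extremal in its direction is a
    nearisometry ([displacement_dot]), while an isometry can only approximate it
    by placing a point at the centre of a ball containing the simplex
    ([near_translation], [simplex_radius]). *)


(** * The Euclidean inner product *)

Lemma dotC (R : realType) (n : nat) (x y : 'rV[R]_n) : dot x y = dot y x.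
Proof. by apply: eq_bigr => i _; rewrite mulrC. Qed.

Lemma dotDl (R : realType) (n : nat) (x y z : 'rV[R]_n) :
  dot (x + y) z = dot x z + dot y z.
Proof. by rewrite -big_split; apply: eq_bigr => i _; rewrite mxE mulrDl. Qed.

Lemma dotZl (R : realType) (n : nat) (a : R) (x y : 'rV[R]_n) :
  dot (a *: x) y = a * dot x y.
Proof. by rewrite mulr_sumr; apply: eq_bigr => i _; rewrite mxE mulrA. Qed.

Lemma dotNl (R : realType) (n : nat) (x y : 'rV[R]_n) : dot (- x) y = - dot x y.
Proof. by rewrite -scaleN1r dotZl mulN1r. Qed.

Lemma dotBl (R : realType) (n : nat) (x y z : 'rV[R]_n) :
  dot (x - y) z = dot x z - dot y z.
Proof. by rewrite dotDl dotNl. Qed.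

Lemma dot0l (R : realType) (n : nat) (x : 'rV[R]_n) : dot 0 x = 0.
Proof. by rewrite -(scale0r 0) dotZl mul0r. Qed.

Lemma dotDr (R : realType) (n : nat) (x y z : 'rV[R]_n) :
  dot z (x + y) = dot z x + dot z y.
Proof. by rewrite !(dotC z) dotDl. Qed.

Lemma dotZr (R : realType) (n : nat) (a : R) (x y : 'rV[R]_n) :
  dot y (a *: x) = a * dot y x.
Proof. by rewrite !(dotC y) dotZl. Qed.

Lemma dotNr (R : realType) (n : nat) (x y : 'rV[R]_n) : dot y (- x) = - dot y x.
Proof. by rewrite !(dotC y) dotNl. Qed.

Lemma dotBr (R : realType) (n : nat) (x y z : 'rV[R]_n) :
  dot z (x - y) = dot z x - dot z y.
Proof. by rewrite !(dotC z) dotBl. Qed.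

Lemma dot0r (R : realType) (n : nat) (x : 'rV[R]_n) : dot x 0 = 0.
Proof. by rewrite dotC dot0l. Qed.

Lemma dot_mulmx (R : realType) (m n : nat) (x : 'rV[R]_m) (M : 'M[R]_(m, n))
    (y : 'rV[R]_n) :
  dot (x *m M) y = dot x (y *m M^T).
Proof.
have dotE k (u v : 'rV[R]_k) : dot u v = (u *m v^T) 0 0.
  by rewrite mxE; apply: eq_bigr => i _; rewrite mxE.
by rewrite !dotE trmx_mul trmxK mulmxA.
Qed.

Lemma dot_delta (R : realType) (n : nat) (x : 'rV[R]_n) (i : 'I_n) :
  dot x (delta_mx 0 i) = x 0 i.
Proof.
rewrite /dot (bigD1 i)//= mxE !eqxx mulr1 big1 ?addr0// => j ji.
by rewrite mxE (negbTE ji) andbF mulr0.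
Qed.

Lemma dotxx_ge0 (R : realType) (n : nat) (x : 'rV[R]_n) : 0 <= dot x x.
Proof. by apply: sumr_ge0 => i _; rewrite -expr2 sqr_ge0. Qed.

Lemma enorm_ge0 (R : realType) (n : nat) (x : 'rV[R]_n) : 0 <= enorm x.
Proof. exact: sqrtr_ge0. Qed.

Lemma sqr_enorm (R : realType) (n : nat) (x : 'rV[R]_n) :
  enorm x ^+ 2 = dot x x.
Proof. by rewrite sqr_sqrtr ?dotxx_ge0. Qed.

Lemma sqr_coord_le (R : realType) (n : nat) (x : 'rV[R]_n) (i : 'I_n) :
  x 0 i ^+ 2 <= dot x x.
Proof.
rewrite /dot (bigD1 i)//= -expr2 lerDl.
by apply: sumr_ge0 => j _; rewrite -expr2 sqr_ge0.
Qed.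

Lemma coord_le_enorm (R : realType) (n : nat) (x : 'rV[R]_n) (i : 'I_n) :
  `|x 0 i| <= enorm x.
Proof.
rewrite -(ler_sqr (normr_ge0 _) (enorm_ge0 _)) sqr_enorm real_normK ?num_real//.
exact: sqr_coord_le.
Qed.

Lemma enorm0_eq0 (R : realType) (n : nat) (x : 'rV[R]_n) : enorm x = 0 -> x = 0.
Proof.
move=> x0; apply/rowP => i; rewrite mxE; apply/eqP.
by rewrite -normr_le0 -x0 coord_le_enorm.
Qed.

Lemma enorm_gt0 (R : realType) (n : nat) (x : 'rV[R]_n) : x != 0 -> 0 < enorm x.
Proof.
move=> x0; rewrite lt_neqAle enorm_ge0 andbT eq_sym.
by apply: contraNneq x0 => /enorm0_eq0/eqP.
Qed.

Lemma enorm0 (R : realType) (n : nat) : enorm (0 : 'rV[R]_n) = 0.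
Proof. by rewrite /enorm dot0l sqrtr0. Qed.

Lemma enormZ (R : realType) (n : nat) (a : R) (x : 'rV[R]_n) :
  enorm (a *: x) = `|a| * enorm x.
Proof.
by rewrite /enorm dotZl dotZr mulrA -expr2 sqrtrM ?sqr_ge0// sqrtr_sqr.
Qed.

Lemma enormN (R : realType) (n : nat) (x : 'rV[R]_n) : enorm (- x) = enorm x.
Proof. by rewrite -scaleN1r enormZ normrN1 mul1r. Qed.

Lemma enorm_distC (R : realType) (n : nat) (x y : 'rV[R]_n) :
  enorm (x - y) = enorm (y - x).
Proof. by rewrite -enormN opprB. Qed.

Lemma enorm_normalize (R : realType) (n : nat) (x : 'rV[R]_n) :
  x != 0 -> enorm ((enorm x)^-1 *: x) = 1.
Proof.
move=> /enorm_gt0 x0.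
by rewrite enormZ ger0_norm ?invr_ge0 ?ltW// mulVf// gt_eqF.
Qed.

Lemma enorm_delta (R : realType) (n : nat) (i : 'I_n) :
  enorm (delta_mx 0 i : 'rV[R]_n) = 1.
Proof. by rewrite /enorm dot_delta mxE !eqxx sqrtr1. Qed.

Lemma sqr_enormD (R : realType) (n : nat) (x y : 'rV[R]_n) :
  enorm (x + y) ^+ 2 = enorm x ^+ 2 + 2 * dot x y + enorm y ^+ 2.
Proof. by rewrite !sqr_enorm dotDl !dotDr (dotC y x); ring. Qed.

Lemma sqr_enormB (R : realType) (n : nat) (x y : 'rV[R]_n) :
  enorm (x - y) ^+ 2 = enorm x ^+ 2 - 2 * dot x y + enorm y ^+ 2.
Proof. by rewrite sqr_enormD dotNr enormN mulrN. Qed.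

Lemma CauchySchwarz (R : realType) (n : nat) (x y : 'rV[R]_n) :
  `|dot x y| <= enorm x * enorm y.
Proof.
have [->|/enorm_gt0 x0] := eqVneq x 0.
  by rewrite dot0l normr0 enorm0 mul0r.
have xy0 : 0 <= enorm x * enorm y by rewrite mulr_ge0 ?enorm_ge0.
rewrite -(ler_sqr (normr_ge0 _) xy0) real_normK ?num_real//.
have := sqr_ge0 (enorm (enorm x ^+ 2 *: y - dot x y *: x)).
rewrite sqr_enormB !enormZ dotZl dotZr (dotC y x).
rewrite ![in X in X -> _]exprMn !real_normK ?num_real// => h.
rewrite exprMn -(ler_pM2l (exprn_gt0 2 x0)); move: h.
set a := enorm x ^+ 2; set b := enorm y ^+ 2; set c := dot x y.
by nra.
Qed.

Lemma enorm_triangle (R : realType) (n : nat) (x y : 'rV[R]_n) :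
  enorm (x + y) <= enorm x + enorm y.
Proof.
rewrite -ler_sqr ?nnegrE ?addr_ge0 ?enorm_ge0// sqr_enormD.
by have := ler_normlW (CauchySchwarz x y); nra.
Qed.

Lemma enorm_triangleB (R : realType) (n : nat) (x y : 'rV[R]_n) :
  enorm (x - y) <= enorm x + enorm y.
Proof. by rewrite -(enormN y) enorm_triangle. Qed.

Lemma enorm_sub_le (R : realType) (n : nat) (x y : 'rV[R]_n) :
  enorm x - enorm y <= enorm (x - y).
Proof. by rewrite lerBlDr -{1}(subrK y x) enorm_triangle. Qed.

(** First order expansion of the norm far from the origin: the linear term is
    the projection onto the direction of [z].  The lower bound is
    Cauchy-Schwarz against [z], the upper one the inequality
    [2 * |z| * |z + q| <= |z| ^ 2 + |z + q| ^ 2]. *)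
Lemma enorm_expansion (R : realType) (n : nat) (z q : 'rV[R]_n) : z != 0 ->
  0 <= enorm (z + q) - enorm z - dot q z / enorm z
    <= enorm q ^+ 2 / (2 * enorm z).
Proof.
move=> /enorm_gt0 z0; apply/andP; split.
  rewrite -(pmulr_lge0 _ z0) mulrC !mulrBr mulrCA divff ?gt_eqF// mulr1.
  have := ler_normlW (CauchySchwarz z (z + q)).
  by rewrite dotDr -sqr_enorm (dotC z q); nra.
rewrite -(ler_pM2l z0) !mulrBr mulrCA divff ?gt_eqF// mulr1.
have -> : enorm z * (enorm q ^+ 2 / (2 * enorm z)) = enorm q ^+ 2 / 2.
  by field; rewrite gt_eqF.
have := sqr_ge0 (enorm (z + q) - enorm z).
have := sqr_enormD z q; rewrite (dotC z q); nra.
Qed.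

Lemma enorm_perturb (R : realType) (n : nat) (z q : 'rV[R]_n) (a b : R) :
  0 < enorm z -> `|dot q z| <= a * enorm z -> enorm q ^+ 2 <= b * enorm z ->
  `|enorm (z + q) - enorm z| <= a + b.
Proof.
move=> z0 ha hb.
have zn0 : z != 0 by apply: contraTneq z0 => ->; rewrite enorm0 ltxx.
have {}ha : `|dot q z / enorm z| <= a.
  by rewrite normrM normfV (gtr0_norm z0) ler_pdivrMr.
have {}hb : enorm q ^+ 2 / (2 * enorm z) <= b / 2.
  by rewrite invfM mulrCA mulrC ler_pM2r ?invr_gt0// ler_pdivrMr.
have q0 : 0 <= enorm q ^+ 2 / (2 * enorm z).
  by rewrite divr_ge0 ?sqr_ge0 ?mulr_ge0// ltW.
have := enorm_expansion q zn0.
move: ha; rewrite !ler_norml; lra.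
Qed.

(** * Subsequences and coordinatewise limits *)

Lemma increasing_seq_cvg_infty (g : nat -> nat) :
  increasing_seq g -> g j @[j --> \oo] --> \oo.
Proof.
move=> /increasing_seqP gS.
have gj j : (j <= g j)%N.
  by elim: j => // k IH; exact: leq_ltn_trans IH (gS k).
apply/cvgnyPge => N; near=> j.
by apply: leq_trans (gj j); near: j; exact: nbhs_infty_ge.
Unshelve. all: by end_near. Qed.

Lemma cvg_comp_increasing (R : realType) (u : nat -> R) (g : nat -> nat)
    (F : set_system R) : increasing_seq g ->
  u j @[j --> \oo] --> F -> u (g j) @[j --> \oo] --> F.
Proof.
move=> /increasing_seq_cvg_infty gy uF.
exact: (cvg_comp g u gy uF).
Qed.

(** Bolzano-Weierstrass, extracting a subsequence for one index after the other. *)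
Lemma common_subsequence (R : realType) (I : finType) (u : I -> nat -> R) :
  (forall i, exists B, forall j, `|u i j| <= B) ->
  exists2 g : nat -> nat, increasing_seq g &
    exists l : I -> R, forall i, u i (g j) @[j --> \oo] --> l i.
Proof.
move=> ub.
suff [g gi gc] : exists2 g : nat -> nat, increasing_seq g &
    forall i, i \in enum I -> cvgn (u i \o g).
  exists g => //; exists (fun i => limn (u i \o g)) => i.
  by apply: gc; rewrite mem_enum.
elim: (enum I) => [|i s [g gi gs]]; first by exists id.
have [B iB] := ub i.
have [|h hi hc] := @bolzano_weierstrass R (u i \o g).
  exists B; split; first exact: num_real.
  by move=> M BM j _ /=; rewrite (le_trans (iB _))// ltW.
exists (g \o h) => [|k].
  by move=> a b; rewrite /= (gi (h a) (h b)); exact: hi.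
rewrite inE => /orP[/eqP ->//|/gs ks].
apply/cvg_ex; exists (limn (u k \o g)).
exact: (cvg_comp_increasing (u := u k \o g) hi ks).
Qed.

Lemma dot_cvg (R : realType) (n : nat) (x y : nat -> 'rV[R]_n) (a b : 'rV[R]_n) :
  (forall i, x j 0 i @[j --> \oo] --> a 0 i) ->
  (forall i, y j 0 i @[j --> \oo] --> b 0 i) ->
  dot (x j) (y j) @[j --> \oo] --> dot a b.
Proof.
move=> xa yb; rewrite /dot.
apply: (@cvg_big _ _ _ _ _ _ _ _ _ (fun i j => x j 0 i * y j 0 i)) => [|i _].
  exact: add_continuous.
exact: cvgM.
Qed.

Lemma dot_cvgl (R : realType) (n : nat) (x : nat -> 'rV[R]_n) (a b : 'rV[R]_n) :
  (forall i, x j 0 i @[j --> \oo] --> a 0 i) ->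
  dot (x j) b @[j --> \oo] --> dot a b.
Proof. by move=> xa; apply: dot_cvg => // i; exact: cvg_cst. Qed.

Lemma enorm_cvg (R : realType) (n : nat) (x : nat -> 'rV[R]_n) (a : 'rV[R]_n) :
  (forall i, x j 0 i @[j --> \oo] --> a 0 i) ->
  enorm (x j) @[j --> \oo] --> enorm a.
Proof.
move=> xa; rewrite /enorm.
apply: (cvg_comp (fun j => dot (x j) (x j)) Num.sqrt (dot_cvg xa xa)).
exact: sqrt_continuous.
Qed.

Lemma coord_cvg_enorm (R : realType) (n : nat) (x : nat -> 'rV[R]_n)
    (a : 'rV[R]_n) :
  enorm (x j - a) @[j --> \oo] --> (0 : R) ->
  forall i, x j 0 i @[j --> \oo] --> a 0 i.
Proof.
move=> /cvgr0Pnorm_le xa i; apply/subr_cvg0/cvgr0Pnorm_le => e e0.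
apply: filterS (xa e e0) => j.
rewrite (ger0_norm (enorm_ge0 _)); apply: le_trans.
by rewrite -[_ - _](_ : (x j - a) 0 i = _) ?coord_le_enorm// !mxE.
Qed.

Lemma enorm_cvg_coord (R : realType) (n : nat) (x : nat -> 'rV[R]_n)
    (a : 'rV[R]_n) :
  (forall i, x j 0 i @[j --> \oo] --> a 0 i) ->
  enorm (x j - a) @[j --> \oo] --> (0 : R).
Proof.
move=> xa; rewrite -(enorm0 R n) -(subrr a); apply: enorm_cvg => i.
rewrite !mxE; under eq_cvg do rewrite !mxE.
by apply: cvgB => //; exact: cvg_cst.
Qed.

Lemma bounded_subsequence (R : realType) (n : nat) (x : nat -> 'rV[R]_n) (B : R) :
  (forall j, enorm (x j) <= B) ->
  exists2 g : nat -> nat, increasing_seq g &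
    exists l : 'rV[R]_n, forall i, x (g j) 0 i @[j --> \oo] --> l 0 i.
Proof.
move=> xB.
have [|g gi [l gl]] := @common_subsequence R 'I_n (fun i j => x j 0 i).
  by move=> i; exists B => j; exact: le_trans (coord_le_enorm _ _) (xB j).
exists g => //; exists (\row_i l i) => i; rewrite mxE; exact: gl.
Qed.

(** Points approaching the direction at the rate [1 / k.+1] form a sequence as
    required in the definition; this form is easier to establish for a given
    set. *)
Lemma cluster_directionsP (R : realType) (n : nat) (A : set 'rV[R]_n)
    (u : 'rV[R]_n) :
  cluster_directions A u <->
  enorm u = 1 /\ forall k : nat, exists x, [/\ A x, k%:R <= enorm x &
    enorm ((enorm x)^-1 *: x - u) <= k.+1%:R^-1].
Proof.
split=> [[u1 [x [xA xoo xu]]]|[u1 h]]; split=> //.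
  move=> k.
  have [j [kj uj]] : exists j, k%:R <= enorm (x j) /\
      enorm ((enorm (x j))^-1 *: x j - u) <= k.+1%:R^-1.
    have /cvgryPge/(_ k%:R) h1 := xoo.
    have k0 : (0 : R) < k.+1%:R^-1 by rewrite invr_gt0.
    have /cvgr0Pnorm_le/(_ _ k0) h2 := xu.
    have [j [/= kj uj]] := filter_ex (filterI h1 h2).
    exists j; split=> //; move: uj.
    by rewrite ger0_norm ?enorm_ge0.
  by exists (x j).
have [x hx] := choice h; exists x; split.
- by move=> j; have [] := hx j.
- apply: (@ger_cvgy _ _ _ _ (fun j => j%:R)); last exact: cvgr_idn.
  by near=> j; have [] := hx j.
- apply: (@squeeze_cvgr _ _ _ _ (cst 0) (@harmonic R)).
  + by near=> j; rewrite enorm_ge0/=; have [] := hx j.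
  + exact: cvg_cst.
  + exact: cvg_harmonic.
Unshelve. all: by end_near. Qed.

(** Compactness of the unit sphere: points of the set going to infinity
    accumulate at some cluster direction. *)
Lemma cluster_direction_subsequence (R : realType) (n : nat) (A : set 'rV[R]_n)
    (x : nat -> 'rV[R]_n) :
  (forall j, A (x j)) -> (forall j, j.+1%:R <= enorm (x j)) ->
  exists2 g : nat -> nat, increasing_seq g & exists2 u, cluster_directions A u &
    forall i, ((enorm (x (g j)))^-1 *: x (g j)) 0 i @[j --> \oo] --> u 0 i.
Proof.
move=> xA xoo.
have x1 j : enorm ((enorm (x j))^-1 *: x j) = 1.
  apply: enorm_normalize; apply: contraTneq (xoo j) => ->.
  by rewrite enorm0 -ltNge.
have [|g gi [u gu]] := @bounded_subsequence R n
    (fun j => (enorm (x j))^-1 *: x j) 1; first by move=> j; rewrite x1.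
exists g => //; exists u => //; split.
  have := enorm_cvg gu; under eq_cvg do rewrite x1.
  by move/cvg_unique; apply => //; exact: cvg_cst.
exists (x \o g); split=> //=; last exact: enorm_cvg_coord gu.
apply: (cvg_comp_increasing (u := fun j => enorm (x j)) gi).
apply: (@ger_cvgy _ _ _ _ (fun j => j%:R)); last exact: cvgr_idn.
by near=> j; rewrite (le_trans _ (xoo j))// ler_nat.
Unshelve. all: by end_near. Qed.

(** * Linear algebra: finite spanning families and orthogonal matrices *)

(** A family of elements of [X] of maximal rank spans [X]. *)
Lemma spanning_rows (F : fieldType) (n : nat) (X : set 'rV[F]_n) :
  exists m (M : 'M[F]_(m, n)),
    (forall i, X (row i M)) /\ forall x, X x -> (x <= M)%MS.
Proof.
suff H k m (M : 'M[F]_(m, n)) : (n - \rank M <= k)%N ->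
    (forall i, X (row i M)) -> exists m (M : 'M[F]_(m, n)),
    (forall i, X (row i M)) /\ forall x, X x -> (x <= M)%MS.
  by apply: (H n 0%N 0) => [|[]//]; rewrite leq_subr.
elim: k m M => [|k IH] m M rM XM.
  exists m, M; split=> // x _; apply: submx_full.
  by rewrite /row_full eqn_leq rank_leq_col -subn_eq0 -leqn0.
have [MX|] := pselect (forall x, X x -> (x <= M)%MS); first by exists m, M.
move=> /existsNP[x /not_implyP[Xx /negP xM]].
apply: (IH _ (col_mx M x)).
  have : (\rank M < \rank (col_mx M x))%N.
    apply: rank_ltmx; rewrite /ltmx -addsmxE addsmxSl/=.
    by apply: contra xM; apply: submx_trans; rewrite -addsmxE addsmxSr.
  by have := rank_leq_col (col_mx M x); move: rM; lia.
move=> i; rewrite -(splitK i); case: (fintype.split i) => j /=.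
  by rewrite rowKu.
by rewrite rowKd (ord1 j) row_id.
Qed.

Lemma orthogonal_dot (R : realType) (n : nat) (Q : 'M[R]_n) (x y : 'rV[R]_n) :
  Q *m Q^T = 1%:M -> dot (x *m Q) (y *m Q) = dot x y.
Proof. by move=> QQ; rewrite dot_mulmx -mulmxA QQ mulmx1. Qed.

Lemma orthogonal_enorm (R : realType) (n : nat) (Q : 'M[R]_n) (x : 'rV[R]_n) :
  Q *m Q^T = 1%:M -> enorm (x *m Q) = enorm x.
Proof. by move=> QQ; rewrite /enorm orthogonal_dot. Qed.

Lemma eq_of_dot (R : realType) (n : nat) (x y : 'rV[R]_n) :
  dot x y = dot y y -> dot x x = dot y y -> x = y.
Proof.
move=> xy xx; apply/eqP; rewrite -subr_eq0; apply/eqP/enorm0_eq0.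
by rewrite /enorm dotBl !dotBr (dotC y x) xy xx !subrr sqrtr0.
Qed.

Lemma mulmx_tr_row (R : realType) (m n : nat) (x : 'rV[R]_n) (M : 'M[R]_(m, n))
    i : (x *m M^T) 0 i = dot x (row i M).
Proof. by rewrite mxE; apply: eq_bigr => k _; rewrite !mxE. Qed.

(** A map preserving inner products on a set that spans the space is the
    restriction of an orthogonal matrix: choose finitely many spanning rows
    [M], with images [V]; then [V *m V^T = M *m M^T], and the matrix is [V]
    multiplied by a left inverse of [M]. *)
Lemma orthogonal_extension (R : realType) (n : nat) (X : set 'rV[R]_n)
    (phi : 'rV[R]_n -> 'rV[R]_n) :
  (forall u v, X u -> X v -> dot (phi u) (phi v) = dot u v) ->
  (forall e, (forall u, X u -> dot u e = 0) -> e = 0) ->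
  exists2 Q : 'M[R]_n, Q *m Q^T = 1%:M & forall u, X u -> u *m Q = phi u.
Proof.
move=> phiD Xspan.
have [m [M [XM MX]]] := spanning_rows X.
have fullM : row_full M.
  rewrite -[row_full M](_ : row_free M^T = _); last first.
    by rewrite /row_free /row_full mxrank_tr.
  rewrite -kermx_eq0; apply/eqP/row_matrixP => i; rewrite row0.
  apply: Xspan => u /MX/submxP[c ->].
  rewrite dot_mulmx; set k := kermx _.
  have -> : row i k *m M^T = 0 by rewrite -row_mul mulmx_ker row0.
  by rewrite dot0r.
pose V := \matrix_(i < m) phi (row i M).
pose P := pinvmx M.
have PM : P *m M = 1%:M by exact: mulVpmx.
have VV : V *m V^T = M *m M^T.
  apply/matrixP => i j; have := phiD _ _ (XM i) (XM j).
  rewrite -[X in dot X _](rowK (fun i => phi (row i M)) i).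
  rewrite -[X in dot _ X](rowK (fun i => phi (row i M)) j).
  by rewrite -!mulmx_tr_row -!row_mul !mxE.
have QQ : (P *m V) *m (P *m V)^T = 1%:M.
  rewrite trmx_mul mulmxA -(mulmxA P V) VV mulmxA PM mul1mx -trmx_mul PM.
  by rewrite trmx1.
exists (P *m V) => // u Xu; apply: eq_of_dot; last first.
  by rewrite orthogonal_dot// phiD.
rewrite mulmxA dot_mulmx phiD//.
have -> : phi u *m V^T = u *m M^T.
  by apply/rowP => i; rewrite !mulmx_tr_row rowK phiD.
by rewrite -dot_mulmx -mulmxA PM mulmx1.
Qed.

(** Up to a translation an isometry preserves norms of differences and norms,
    hence inner products. *)
Lemma isometry_affine (R : realType) (n : nat) (T : 'rV[R]_n -> 'rV[R]_n) :
  isometry T ->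
  exists2 Q : 'M[R]_n, Q *m Q^T = 1%:M & forall x, T x = x *m Q + T 0.
Proof.
move=> isoT; pose S x := T x - T 0.
have normS x : enorm (S x) = enorm x by rewrite isoT subr0.
have dotS x y : dot (S x) (S y) = dot x y.
  have := isoT x y; have -> : T x - T y = S x - S y.
    by rewrite /S opprB addrA subrK.
  move=> /(congr1 (fun r => r ^+ 2)).
  rewrite (sqr_enormB (S x)) (sqr_enormB x) !normS; lra.
have [||Q QQ QS] := @orthogonal_extension R n setT S.
- by move=> u v _ _; exact: dotS.
- move=> e /(_ e I) ee0; apply: enorm0_eq0.
  by rewrite /enorm ee0 sqrtr0.
by exists Q => // x; rewrite QS// /S subrK.
Qed.

(** The functionals bounded on [A] form a finite-dimensional space, so those
    in a ball are uniformly bounded on [A]. *)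
Lemma uniform_functional_bound (R : realType) (n : nat) (A : set 'rV[R]_n)
    (r : R) :
  exists K, forall w, enorm w <= r ->
    (exists B, forall x, A x -> `|dot w x| <= B) ->
    forall x, A x -> `|dot w x| <= K.
Proof.
pose W := [set w | exists B, forall x, A x -> `|dot w x| <= B].
have [m [M [WM MW]]] := spanning_rows W.
have [B hB] := choice WM.
pose P := pinvmx M.
exists (\sum_(i < m) (r * \sum_(k < n) `|P k i|) * B i) => w wr Ww x Ax.
rewrite -(mulmxKpV (MW w Ww)) dot_mulmx /dot.
apply: le_trans (ler_norm_sum _ _ _) _; apply: ler_sum => i _.
rewrite normrM ler_pM//; last by rewrite mulmx_tr_row dotC hB.
rewrite mxE (le_trans (ler_norm_sum _ _ _))// mulr_sumr; apply: ler_sum => k _.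
by rewrite normrM ler_wpM2r// (le_trans (coord_le_enorm w k)).
Qed.

(** * Cluster directions and the quantity [mu] *)

Lemma le_sigma (R : realType) (n : nat) (A : set 'rV[R]_n) (e u : 'rV[R]_n) :
  cluster_directions A u -> `|dot u e| <= sigma e (cluster_directions A).
Proof.
move=> Au; apply: ub_le_sup; last by exists u.
exists (enorm e) => _ [v [v1 _] <-].
by rewrite (le_trans (CauchySchwarz _ _))// v1 mul1r.
Qed.

(** A positive lower bound excludes the empty set of cluster directions, for
    which [mu] is [0]; the rest is the homogeneity of [sigma]. *)
Lemma mu_lower_bound (R : realType) (n : nat) (A : set 'rV[R]_n) (s r : R)
    (x : 'rV[R]_n) : 0 < s -> s <= mu A ->
  (forall u, cluster_directions A u -> `|dot u x| <= r) -> s * enorm x <= r.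
Proof.
move=> s0; rewrite /mu /mu1; case: eqP => [_|/eqP/set0P[u Au]].
  by move=> /(lt_le_trans s0); rewrite ltxx.
move=> smu xr.
have [->|x0] := eqVneq x 0.
  by rewrite enorm0 mulr0 (le_trans _ (xr u Au)).
have nx0 := enorm_gt0 x0; rewrite -ler_pdivlMr//; apply: le_trans smu _.
apply: (@le_trans _ _ (sigma ((enorm x)^-1 *: x) (cluster_directions A))).
  apply: ge_inf; last first.
    by exists ((enorm x)^-1 *: x) => //; exact: enorm_normalize.
  by exists 0 => _ [e _ <-]; exact: le_trans (le_sigma e Au).
apply: ge_sup; first by exists (`|dot u ((enorm x)^-1 *: x)|), u.
move=> _ [v Av <-]; rewrite dotZr normrM ger0_norm ?invr_ge0 ?enorm_ge0//.
by rewrite mulrC ler_pM2r ?invr_gt0// xr.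
Qed.

Lemma mu_upper_bound (R : realType) (n : nat) (A : set 'rV[R]_n) (tau : R) :
  (1 <= n)%N -> 0 < tau -> mu A < tau ->
  exists2 e, enorm e = 1 & exists2 s, s < tau &
    forall u, cluster_directions A u -> `|dot u e| <= s.
Proof.
case: n A => // n A _ tau0; rewrite /mu /mu1.
case: eqP => [A0 _|/eqP/set0P[u Au]].
  by exists (delta_mx 0 0); [exact: enorm_delta|exists 0 => // u; rewrite A0].
move=> /inf_lt[|_ [e e1 <-] stau].
  exists (sigma (delta_mx 0 0) (cluster_directions A)), (delta_mx 0 0) => //.
  exact: enorm_delta.
exists e => //; exists (sigma e (cluster_directions A)) => // v.
exact: le_sigma.
Qed.

Lemma mu_full (R : realType) (n : nat) (A : set 'rV[R]_n) : (1 <= n)%N ->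
  (forall e, enorm e = 1 -> cluster_directions A e) -> 1 <= mu A.
Proof.
case: n A => // n A _ Afull; have d1 := enorm_delta R (0 : 'I_n.+1).
rewrite /mu /mu1; case: eqP => [A0|_]; first by have := Afull _ d1; rewrite A0.
apply: lb_le_inf.
  by exists (sigma (delta_mx 0 0) (cluster_directions A)), (delta_mx 0 0).
move=> _ [e e1 <-]; apply: le_trans (le_sigma e (Afull e e1)).
by rewrite -sqr_enorm e1 expr1n normr1.
Qed.

(** * Jung's theorem with a dimension-free constant *)

(** Moving the centre of an almost optimal ball towards a point [p] near its
    boundary improves the ball by a definite amount as long as the squared
    radius exceeds half the squared diameter, because the other points
    near the boundary then make an acute angle with [p] at the centre. *)
Lemma jung_squared_radius (R : realType) (n : nat) (D : set 'rV[R]_n) (d : R) :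
  D !=set0 -> (forall p q, D p -> D q -> enorm (p - q) <= d) ->
  forall s, d ^+ 2 / 2 < s ->
  exists w, forall p, D p -> enorm (p - w) ^+ 2 <= s.
Proof.
move=> [p0 Dp0] Dd s ds.
have sqd p q : D p -> D q -> enorm (p - q) ^+ 2 <= d ^+ 2.
  move=> Dp Dq; have pqd := Dd p q Dp Dq.
  by rewrite lerXn2r ?nnegrE ?enorm_ge0// (le_trans (enorm_ge0 _) pqd).
pose S := [set s | exists w, forall p, D p -> enorm (p - w) ^+ 2 <= s].
have Sup a b : S a -> a <= b -> S b.
  by move=> [w wa] ab; exists w => p /wa /le_trans; apply.
have Sne : S !=set0 by exists (d ^+ 2), p0 => p Dp; exact: sqd.
have Slb : has_lbound S.
  by exists 0 => a [w /(_ p0 Dp0)]; apply: le_trans; exact: sqr_ge0.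
suff infS : inf S <= d ^+ 2 / 2.
  have [a Sa aS] := inf_lt Sne (le_lt_trans infS ds).
  exact: Sup Sa (ltW aS).
rewrite leNgt; apply/negP; set s0 := inf S => ds0.
(* The gain in squared radius is of order [t * eta] for a step [t * (p - w)] of
   the centre, up to a term [t ^+ 2 * s0], which this [t] makes a quarter of it. *)
pose eta : R := 2 * s0 - d ^+ 2.
have d2 : 0 <= d ^+ 2 by exact: sqr_ge0.
have eta0 : 0 < eta by rewrite /eta; lra.
have s00 : 0 < s0 by lra.
pose t : R := eta / (4 * s0).
have t0 : 0 < t by rewrite divr_gt0// mulr_gt0.
have ts : t * s0 = eta / 4 by rewrite /t; field; rewrite gt_eqF.
have t1 : t <= 1 / 2.
  by rewrite -(ler_pM2r s00) ts /eta; lra.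
pose zeta : R := t * eta / 4.
have zeta0 : 0 < zeta by apply: divr_gt0 => //; exact: mulr_gt0.
have [a Sa as0] : exists2 a, S a & a < s0 + zeta.
  by apply: inf_lt => //; rewrite ltrDl.
have [w wD] := Sup _ _ Sa (ltW as0).
have [p Dp pw] : exists2 p, D p & s0 - zeta < enorm (p - w) ^+ 2.
  apply: contrapT => /forall2NP h.
  suff : s0 <= s0 - zeta by rewrite lerBrDr gerDl leNgt zeta0.
  apply: ge_inf => //; exists w => q Dq.
  by have [//|/negP] := h q; rewrite -leNgt.
suff : s0 <= s0 - t * eta / 8.
  by have := mulr_gt0 t0 eta0; lra.
apply: ge_inf => //; exists (w + t *: (p - w)) => q Dq.
rewrite opprD addrA sqr_enormB dotZr enormZ exprMn (ger0_norm (ltW t0)).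
have := sqr_enormB (q - w) (p - w).
rewrite opprB addrA subrK => pq.
have := sqd q p Dq Dp; rewrite pq.
have := wD q Dq; have := wD p Dp; move: pw ts.
set x := enorm (p - w) ^+ 2; set y := enorm (q - w) ^+ 2.
set z := dot _ _ => h1 h2 h3 h4 h5.
have e1 : t * (x - 2 * z + y) <= t * d ^+ 2 by rewrite ler_pM2l//; lra.
have e2 : t * (s0 - zeta) <= t * x by rewrite ler_pM2l// ltW.
have e3 : (1 - t) * y <= (1 - t) * (s0 + zeta) by rewrite ler_wpM2l//; lra.
have e4 : t ^+ 2 * x <= t ^+ 2 * (s0 + zeta) by rewrite ler_wpM2l ?sqr_ge0.
have e5 : t ^+ 2 * s0 = t * eta / 4 :> R by rewrite expr2 -mulrA h2 mulrA.
have e6 : t ^+ 2 * zeta <= zeta / 4.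
  rewrite mulrC ler_pM2l// expr2.
  by apply: le_trans (ler_pM (ltW t0) (ltW t0) t1 t1) _; lra.
have e7 : t * eta = 2 * (t * s0) - t * d ^+ 2 :> R by rewrite /eta; ring.
have e8 : zeta = t * eta / 4 :> R by [].
move: e1 e2 e3 e4 e5 e6 e7 e8; clearbody x y z zeta t eta s0; lra.
Qed.

(** Centres of balls whose squared radii decrease to [d ^+ 2 / 2] are bounded, and
    the limit of a subsequence is the required centre. *)
Lemma jung (R : realType) (n : nat) (D : set 'rV[R]_n) (d : R) :
  D !=set0 -> (forall p q, D p -> D q -> enorm (p - q) <= d) ->
  exists w, forall p, D p -> enorm (p - w) ^+ 2 <= d ^+ 2 / 2.
Proof.
move=> D0 Dd; have [p0 Dp0] := D0.
have /choice[w wD] (k : nat) : exists w, forall p, D p ->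
    enorm (p - w) ^+ 2 <= d ^+ 2 / 2 + k.+1%:R^-1.
  by apply: (jung_squared_radius D0 Dd); rewrite ltrDl invr_gt0.
have [|g gi [l gl]] := @bounded_subsequence R n w (enorm p0 + d ^+ 2 / 2 + 2).
  move=> k; have := wD k p0 Dp0.
  have : k.+1%:R^-1 <= 1 :> R by rewrite invf_le1 ?ler1n.
  have := enorm_sub_le (w k) p0; rewrite enorm_distC.
  have := sqr_ge0 d; have := sqr_ge0 (enorm (p0 - w k) - 1).
  by move: (k.+1%:R^-1) => e; lra.
exists l => p Dp; apply: (@ler_cvg_to _ \oo _ _
  (fun j => enorm (p - w (g j)) ^+ 2) (fun j => d ^+ 2 / 2 + (g j).+1%:R^-1)).
- suff h : enorm (p - w (g j)) @[j --> \oo] --> enorm (p - l).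
    by rewrite expr2; under eq_cvg do rewrite expr2; exact: cvgM.
  apply: enorm_cvg => i.
  by rewrite !mxE; under eq_cvg do rewrite !mxE; apply: cvgB => //; exact: cvg_cst.
- rewrite -[X in _ --> X]addr0; apply: cvgD; first exact: cvg_cst.
  exact: (cvg_comp_increasing (u := @harmonic R) gi cvg_harmonic).
- by near=> j; exact: wD.
Unshelve. all: by end_near. Qed.

(** * Behaviour of a nearisometry at infinity *)

Lemma enorm_sub_asymptotics (R : realType) (n : nat) (z : nat -> 'rV[R]_n)
    (a v : 'rV[R]_n) :
  enorm (z j) @[j --> \oo] --> +oo ->
  (forall i, ((enorm (z j))^-1 *: z j) 0 i @[j --> \oo] --> v 0 i) ->
  enorm (z j - a) - enorm (z j) @[j --> \oo] --> - dot a v.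
Proof.
move=> zoo zv.
have z0 : \forall j \near \oo, 0 < enorm (z j).
  by move/cvgryPge : zoo => /(_ 1); apply: filterS => j; exact: lt_le_trans.
have zV : (enorm (z j))^-1 @[j --> \oo] --> (0 : R) by apply/gtr0_cvgV0.
have lin : - dot ((enorm (z j))^-1 *: z j) a @[j --> \oo] --> - dot a v.
  by rewrite (dotC a); apply: cvgN; exact: dot_cvgl.
apply: (@squeeze_cvgr _ _ _ _ (fun j => - dot ((enorm (z j))^-1 *: z j) a)
  (fun j => - dot ((enorm (z j))^-1 *: z j) a
            + enorm a ^+ 2 / 2 * (enorm (z j))^-1)).
- apply: filterS z0 => j zj.
  have zn0 : z j != 0 by apply: contraTneq zj => ->; rewrite enorm0 ltxx.
  have := enorm_expansion (- a) zn0.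
  rewrite dotNl enormN dotZl dotC mulNr opprK invfM mulrA (mulrC _^-1).
  by move=> /andP[h1 h2]; apply/andP; split; lra.
- exact: lin.
- rewrite -[X in _ --> X]addr0; apply: cvgD => //.
  by rewrite -(mulr0 (enorm a ^+ 2 / 2)); apply: cvgM => //; exact: cvg_cst.
Qed.

(** Along a subsequence tending to infinity in the direction [u], the images
    tend to infinity in a direction [u'] and the norms are shifted by [t] in
    the limit.  Passing to the limit in the inequality between the distances of
    [x] and of [f x] to the moving point yields the estimate. *)
Lemma nearisometry_at_infinity (R : realType) (n : nat) (A : set 'rV[R]_n)
    (eps : R) (f : 'rV[R]_n -> 'rV[R]_n) (u : 'rV[R]_n) :
  nearisometry A eps f -> cluster_directions A u ->
  exists (u' : 'rV[R]_n) (t : R) (y : nat -> 'rV[R]_n),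
  [/\ forall x, A x -> `|dot (f x) u' - dot x u - t| <= eps,
      forall j, A (y j), enorm (y j) @[j --> \oo] --> +oo,
      forall i, ((enorm (y j))^-1 *: y j) 0 i @[j --> \oo] --> u 0 i &
      forall i, ((enorm (y j))^-1 *: f (y j)) 0 i @[j --> \oo] --> u' 0 i].
Proof.
move=> fA [u1 [x [xA xoo xu]]].
pose B := enorm (x 0) + enorm (f (x 0)) + `|eps|.
have normB j : `|enorm (f (x j)) - enorm (x j)| <= B.
  have [h1 h2] := fA _ _ (xA j) (xA 0).
  have := enorm_sub_le (f (x j)) (f (x 0)); have := enorm_sub_le (x j) (x 0).
  have := enorm_triangleB (x j) (x 0); have := enorm_triangleB (f (x j)) (f (x 0)).
  have := ler_norm eps; have := enorm_ge0 (x 0); have := enorm_ge0 (f (x 0)).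
  by rewrite /B ler_norml; lra.
(* The directions of the images and the differences of the norms are bounded,
   hence converge along a common subsequence. *)
pose v (k : option 'I_n) j := if k is Some i
  then ((enorm (f (x j)))^-1 *: f (x j)) 0 i else enorm (f (x j)) - enorm (x j).
have [[i|]|g gi [l gl]] := common_subsequence (u := v).
- exists 1 => j /=; apply: le_trans (coord_le_enorm _ _) _.
  have [->|?] := eqVneq (f (x j)) 0; first by rewrite scaler0 enorm0.
  by rewrite enorm_normalize.
- by exists B.
pose y j := x (g j); pose u' := \row_i l (Some i); pose t := l None.
have yoo : enorm (y j) @[j --> \oo] --> +oo.
  exact: (cvg_comp_increasing (u := fun j => enorm (x j)) gi xoo).
have yu i : ((enorm (y j))^-1 *: y j) 0 i @[j --> \oo] --> u 0 i.
  apply: (cvg_comp_increasing (u := fun j => ((enorm (x j))^-1 *: x j) 0 i) gi).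
  exact: coord_cvg_enorm xu i.
have fyoo : enorm (f (y j)) @[j --> \oo] --> +oo.
  apply/cvgryPge => M; move/cvgryPge : yoo => /(_ (M + B)).
  by apply: filterS => j; have := normB (g j); rewrite ler_norml -/(y j); lra.
have fyu i : ((enorm (f (y j)))^-1 *: f (y j)) 0 i @[j --> \oo] --> u' 0 i.
  by rewrite mxE; exact: gl (Some i).
have yt : enorm (f (y j)) - enorm (y j) @[j --> \oo] --> t by exact: gl None.
exists u', t, y; split=> //.
- move=> a Aa.
  have E : (enorm (f (y j) - f a) - enorm (f (y j)))
           - (enorm (y j - a) - enorm (y j))
           + (enorm (f (y j)) - enorm (y j)) @[j --> \oo]
           --> - dot (f a) u' - - dot a u + t.
    by apply: cvgD => //; apply: cvgB; exact: enorm_sub_asymptotics.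
  have := cvg_norm E; rewrite -normrN !opprD !opprK => nE.
  apply: (ler_cvg_to (nE _) (cvg_cst eps)); near=> j.
  have [h1 h2] := fA _ _ (xA (g j)) Aa.
  by rewrite ler_norml -/(y j) in h1 h2 *; lra.
- by move=> j; exact: xA.
- move=> i; have y0 : \forall j \near \oo, 0 < enorm (y j).
    by move/cvgryPge : yoo => /(_ 1); apply: filterS => j; exact: lt_le_trans.
  have fy0 : \forall j \near \oo, 0 < enorm (f (y j)).
    by move/cvgryPge : fyoo => /(_ 1); apply: filterS => j; exact: lt_le_trans.
  have yV : (enorm (y j))^-1 @[j --> \oo] --> (0 : R) by apply/gtr0_cvgV0.
  have : ((enorm (f (y j)) - enorm (y j)) * (enorm (y j))^-1 + 1) *
      ((enorm (f (y j)))^-1 *: f (y j)) 0 i @[j --> \oo] --> (t * 0 + 1) * u' 0 i.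
    by apply: cvgM => //; apply: cvgD; [exact: cvgM|exact: cvg_cst].
  rewrite mulr0 add0r mul1r; apply: cvg_trans; apply: near_eq_cvg.
  near=> j; have yj : 0 < enorm (y j) by near: j.
  have fyj : 0 < enorm (f (y j)) by near: j.
  by rewrite !mxE; field; rewrite !gt_eqF.
Unshelve. all: by end_near. Qed.

(** * A lower bound on [mu] implies the isometric approximation property *)

Lemma unbounded_far (R : realType) (n : nat) (A : set 'rV[R]_n) (M : R) :
  unbounded A -> exists2 x, A x & M < enorm x.
Proof.
move=> Aub; apply: contrapT => /forall2NP h; apply: Aub; exists M => x Ax.
by rewrite leNgt; apply/negP; have [|] := h x.
Qed.

(** Inserting in the estimate at infinity for [u] a sequence going to infinity
    in the direction [v], and dividing by its norm. *)
Lemma directions_at_infinity_dot (R : realType) (n : nat) (eps t : R)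
    (f : 'rV[R]_n -> 'rV[R]_n) (y : nat -> 'rV[R]_n) (u u' v v' : 'rV[R]_n) :
  (forall j, `|dot (f (y j)) u' - dot (y j) u - t| <= eps) ->
  enorm (y j) @[j --> \oo] --> +oo ->
  (forall i, ((enorm (y j))^-1 *: y j) 0 i @[j --> \oo] --> v 0 i) ->
  (forall i, ((enorm (y j))^-1 *: f (y j)) 0 i @[j --> \oo] --> v' 0 i) ->
  dot v' u' = dot v u.
Proof.
move=> fyu yoo yv fyv.
have y0 : \forall j \near \oo, 0 < enorm (y j).
  by move/cvgryPge : yoo => /(_ 1); apply: filterS => j; exact: lt_le_trans.
have yV : (enorm (y j))^-1 @[j --> \oo] --> (0 : R) by apply/gtr0_cvgV0.
have E : dot ((enorm (y j))^-1 *: f (y j)) u' - dot ((enorm (y j))^-1 *: y j) u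
    @[j --> \oo] --> dot v' u' - dot v u by apply: cvgB; exact: dot_cvgl.
have V : (eps + `|t|) * (enorm (y j))^-1 @[j --> \oo] --> (eps + `|t|) * 0.
  by apply: cvgM => //; exact: cvg_cst.
have nE := cvg_norm E.
suff h : `|dot v' u' - dot v u| <= (eps + `|t|) * 0.
  by apply/eqP; rewrite -subr_eq0 -normr_le0 -[leRHS](mulr0 (eps + `|t|)).
apply: (ler_cvg_to (nE _) V); near=> j.
have yj : 0 < enorm (y j) by near: j.
rewrite !dotZl -mulrBr normrM gtr0_norm ?invr_gt0// mulrC.
rewrite ler_pM2r ?invr_gt0// -[X in `|X|](subrK t).
by rewrite (le_trans (ler_normD _ _))// lerD2r fyu.
Unshelve. all: by end_near. Qed.

(** With [Q] the orthogonal matrix sending cluster directions to their images,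
    the vectors [f x - x *m Q] differ by at most [2 * eps] in the image of each
    cluster direction, which bounds the diameter [d] of their set by
    [2 * c' * eps]; the radius [d / sqrt 2] of Jung's theorem is then
    [sqrt 2 * c' * eps]. *)
Lemma mu_large_IAP (R : realType) (n : nat) (A : set 'rV[R]_n) (c' : R) :
  unbounded A -> 0 < c' -> 1 / c' <= mu A -> IAP (Num.sqrt 2%:R * c') A.
Proof.
move=> Aub c0 muA eps f eps0 fA.
have muV : 0 < 1 / c' by rewrite divr_gt0.
have /choice[a ha] (u : 'rV[R]_n) : exists a : 'rV[R]_n * R * (nat -> 'rV[R]_n),
    cluster_directions A u ->
    [/\ forall x, A x -> `|dot (f x) a.1.1 - dot x u - a.1.2| <= eps,
      forall j, A (a.2 j), enorm (a.2 j) @[j --> \oo] --> +oo,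
      forall i, ((enorm (a.2 j))^-1 *: a.2 j) 0 i @[j --> \oo] --> u 0 i &
      forall i, ((enorm (a.2 j))^-1 *: f (a.2 j)) 0 i @[j --> \oo]
        --> a.1.1 0 i].
  have [Au|nAu] := pselect (cluster_directions A u); last by exists (0, 0, fun=> 0).
  have [u' [t [y h]]] := nearisometry_at_infinity fA Au.
  by exists (u', t, y).
have [u v Au Av|e Ae|Q QQ Qphi] := @orthogonal_extension R n
    (cluster_directions A) (fun u => (a u).1.1).
- have [_ yA yoo yv fyv] := ha v Av; have [fu _ _ _ _] := ha u Au.
  rewrite dotC (dotC u).
  apply: (directions_at_infinity_dot _ yoo yv fyv) => j; exact: fu.
- apply: enorm0_eq0; apply/eqP; rewrite eq_le enorm_ge0 andbT.
  rewrite -(pmulr_rle0 _ muV); apply: (mu_lower_bound muV muA) => u Au.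
  by rewrite Ae// normr0.
pose D := [set f x - x *m Q | x in A].
have Dphi u p : cluster_directions A u -> D p ->
    `|dot p (u *m Q) - (a u).1.2| <= eps.
  move=> Au [x Ax <-]; have [fu _ _ _ _] := ha u Au.
  by rewrite dotBl orthogonal_dot// Qphi// fu.
have QtQ : Q^T *m Q^T^T = 1%:M by rewrite trmxK; exact: mulmx1C.
have diamD p q : D p -> D q -> enorm (p - q) <= 2 * c' * eps.
  move=> Dp Dq; rewrite -(orthogonal_enorm _ QtQ).
  have : 1 / c' * enorm ((p - q) *m Q^T) <= 2 * eps.
    apply: (mu_lower_bound muV muA) => u Au.
    rewrite -dot_mulmx dotBr !(dotC (u *m Q)).
    by have := Dphi u p Au Dp; have := Dphi u q Au Dq; rewrite !ler_norml; lra.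
  by rewrite div1r mulrC ler_pdivrMr// mulrAC.
have [x0 Ax0 _] := unbounded_far 0 Aub.
have [|w wD] := jung _ diamD; first by exists (f x0 - x0 *m Q), x0.
exists (fun x => x *m Q + w) => [x y|].
  by rewrite opprD addrACA subrr addr0 -mulmxBl orthogonal_enorm.
apply: ge_ereal_sup => _ [x Ax <-]; rewrite lee_fin.
have Dx : D (f x - x *m Q) by exists x.
rewrite enorm_distC opprD addrA.
have c2 : 0 <= Num.sqrt 2%:R * c' * eps.
  by rewrite mulr_ge0// mulr_ge0 ?sqrtr_ge0// ltW.
rewrite -ler_sqr ?nnegrE ?enorm_ge0//.
rewrite (le_trans (wD _ Dx))// !exprMn sqr_sqrtr ?ler0n//.
by lra.
Qed.

(** * The isometric approximation property implies a lower bound on [mu] *)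

Lemma IAP_bound (R : realType) (n : nat) (A : set 'rV[R]_n) (c eps : R)
    (f : 'rV[R]_n -> 'rV[R]_n) :
  IAP c A -> 0 <= eps -> nearisometry A eps f ->
  exists2 T : 'rV[R]_n -> 'rV[R]_n, isometry T &
    forall x, A x -> enorm (T x - f x) <= c * eps.
Proof.
move=> /(_ eps f) h eps0 /(h eps0)[T isoT hT]; exists T => // x Ax.
rewrite -lee_fin; apply: le_trans hT; apply: ereal_sup_ubound.
by exists x.
Qed.

(** Far points violating the bound would accumulate at a cluster direction [u]
    with [tau <= |u . e|]. *)
Lemma cone_condition (R : realType) (n : nat) (A : set 'rV[R]_n)
    (e : 'rV[R]_n) (s tau : R) : s < tau ->
  (forall u, cluster_directions A u -> `|dot u e| <= s) ->
  exists M, forall x, A x -> M <= enorm x -> `|dot x e| <= tau * enorm x.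
Proof.
move=> stau cde; apply: contrapT => /forallNP h.
have /choice[x hx] (j : nat) : exists x, [/\ A x, j.+1%:R <= enorm x &
    tau * enorm x < `|dot x e|].
  have /existsNP[x /not_implyP[Ax /not_implyP[jx /negP]]] := h j.+1%:R.
  by rewrite -ltNge; exists x.
have [||g gi [u Au gu]] := @cluster_direction_subsequence R n A x.
- by move=> j; have [] := hx j.
- by move=> j; have [] := hx j.
have E := cvg_norm (dot_cvgl (b := e) gu).
suff /(lt_le_trans stau) : tau <= `|dot u e| by rewrite ltNge cde.
apply: (ler_cvg_to (cvg_cst tau) (E _)); near=> j.
have [_ jx dx] := hx (g j).
have x0 : 0 < enorm (x (g j)) by exact: lt_le_trans jx.
by rewrite dotZl normrM gtr0_norm ?invr_gt0// mulrC ler_pdivlMr// ltW.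
Unshelve. all: by end_near. Qed.

(** The logarithm turns bounded ratios of radii into bounded increments, which
    become small after scaling; truncation makes the function bounded. *)
Lemma slow_cutoff (R : realType) (L d r0 : R) : 1 < L -> 0 < d -> 0 < r0 ->
  exists h : R -> R, [/\ forall r, 0 <= h r <= 1,
    forall r, r <= r0 -> h r = 0,
    exists r1, forall r, r1 <= r -> h r = 1 &
    forall r s, s <= r -> r <= L * s -> `|h r - h s| <= d].
Proof.
move=> L1 d0 r00; have L0 : 0 < L by exact: lt_trans L1.
have lnL : 0 < ln L by exact: ln_gt0.
pose k r := ln (Num.max 1 (r / r0)) * (d / ln L).
have dL : 0 < d / ln L by exact: divr_gt0.
have max1 r : 1 <= Num.max 1 (r / r0) by rewrite le_max lexx.
have max0 r : 0 < Num.max 1 (r / r0) by exact: lt_le_trans (max1 r).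
have k0 r : 0 <= k r by rewrite mulr_ge0 ?(ltW dL)// ln_ge0.
exists (fun r => Num.min 1 (k r)); split.
- by move=> r; rewrite le_min ler01 k0 ge_min lexx.
- move=> r rr0; rewrite /k max_l ?ler_pdivrMr ?mul1r// ln1 mul0r.
  by rewrite min_r.
- exists (r0 * expR (ln L / d)) => r rr; apply/min_idPl.
  have E : expR (ln L / d) <= Num.max 1 (r / r0).
    by rewrite le_max ler_pdivlMr// [_ * r0]mulrC rr orbT.
  rewrite /k -[leLHS](_ : ln L / d * (d / ln L) = 1); last first.
    by field; rewrite !gt_eqF.
  rewrite ler_pM2r//.
  by rewrite -[leLHS]expRK ler_ln ?posrE ?expR_gt0.
- move=> r s sr rLs.
  have ksr : k s <= k r.
    rewrite ler_pM2r// ler_ln ?posrE// ge_max max1/= le_max.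
    by rewrite ler_pM2r ?invr_gt0// sr orbT.
  have krs : k r <= k s + d.
    have -> : d = ln L * (d / ln L) by field; rewrite gt_eqF.
    rewrite -mulrDl ler_pM2r// -lnM ?posrE// ler_ln ?posrE ?mulr_gt0//.
    rewrite ge_max -[1 in leLHS]mulr1 ler_pM ?ler01 ?max1 ?(ltW L1)//=.
    apply: (@le_trans _ _ (s / r0 * L)).
      by rewrite mulrAC ler_pM2r ?invr_gt0// mulrC.
    by rewrite ler_pM2r// le_max lexx orbT.
  rewrite /Num.min; move: (k r) (k s) ksr krs => a b ba ab.
  by case: (ltP 1 a) => ?; case: (ltP 1 b) => ?; rewrite ler_norml; lra.
Qed.

(** Far from the origin the vector [e] is almost orthogonal to [A], so that
    moving the points slowly from displacement [0] to [t *: e] as their norm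
    grows changes distances very little: two points with comparable norms are
    displaced by almost the same vector, and otherwise their difference is
    almost parallel to the farther point. *)
Lemma slow_translation_nearisometry (R : realType) (n : nat)
    (A : set 'rV[R]_n) (e : 'rV[R]_n) (tau t M : R) :
  enorm e = 1 -> 0 < tau -> 0 < t ->
  (forall x, A x -> M <= enorm x -> `|dot x e| <= tau * enorm x) ->
  forall r, exists h : R -> R, [/\ forall s, 0 <= h s <= 1,
    forall s, s <= r -> h s = 0,
    exists r1, forall s, r1 <= s -> h s = 1 &
    nearisometry A (8%:R * tau * t) (fun x => x + (t * h (enorm x)) *: e)].
Proof.
move=> e1 tau0 t0 cone r.
(* Beyond [r0] the cone condition holds and [t] is negligible; points whose
   norms have a ratio larger than [L] count as far from each other. *)
pose r0 := 1 + `|M| + `|r| + t / tau.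
have ttau : 0 < t / tau by exact: divr_gt0.
have [M0 rM] : 0 <= `|M| /\ 0 <= `|r| by split.
have r00 : 0 < r0 by rewrite /r0; lra.
pose L := 4%:R / tau + 4%:R.
have tauV : 0 < 4%:R / tau by exact: divr_gt0.
have [|h [h01 h0 h1 hL]] := @slow_cutoff R L tau r0 _ tau0 r00.
  by rewrite /L; lra.
exists h; split=> // [s sr|].
  by apply: h0; have := ler_norm r; rewrite /r0; lra.
suff H x y : A x -> A y -> enorm y <= enorm x ->
    `|enorm ((x + (t * h (enorm x)) *: e) - (y + (t * h (enorm y)) *: e))
      - enorm (x - y)| <= 8%:R * tau * t.
  move=> x y Ax Ay; have [yx|/ltW xy] := leP (enorm y) (enorm x).
    by have := H _ _ Ax Ay yx; rewrite ler_norml; lra.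
  have := H _ _ Ay Ax xy; rewrite enorm_distC (enorm_distC y) ler_norml; lra.
move=> Ax Ay yx; set q := (t * (h (enorm x) - h (enorm y))) *: e.
have -> : x + (t * h (enorm x)) *: e - (y + (t * h (enorm y)) *: e)
    = (x - y) + q.
  by rewrite /q mulrBr scalerBl opprD addrACA.
have nq : enorm q = t * `|h (enorm x) - h (enorm y)|.
  by rewrite enormZ e1 mulr1 normrM gtr0_norm.
have qle : `|enorm (x - y + q) - enorm (x - y)| <= enorm q.
  rewrite ler_norml; have := enorm_triangle (x - y) q.
  by have := enorm_triangleB (x - y + q) q; rewrite addrK; lra.
have tt : 0 < tau * t by exact: mulr_gt0.
have [xr0|r0x] := leP (enorm x) r0.
  apply: le_trans qle _; rewrite nq !h0 ?(le_trans yx)// subrr normr0 mulr0.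
  by rewrite -mulrA; lra.
have [xLy|Lyx] := leP (enorm x) (L * enorm y).
  apply: le_trans qle _; rewrite nq.
  apply: (@le_trans _ _ (t * tau)); last by rewrite -mulrA; lra.
  by rewrite ler_pM2l// hL.
have y0 := enorm_ge0 y.
have ytau : 4%:R * enorm y <= tau * enorm x.
  have : tau * (L * enorm y) <= tau * enorm x by rewrite ler_pM2l// ltW.
  have -> : tau * (L * enorm y) = 4%:R * enorm y + 4%:R * (tau * enorm y).
    by rewrite /L; field; rewrite gt_eqF.
  by have := mulr_ge0 (ltW tau0) y0; lra.
have y4 : 4%:R * enorm y <= enorm x.
  have : 0 <= 4%:R / tau * enorm y by rewrite mulr_ge0// ltW.
  by move: Lyx; rewrite /L mulrDl; lra.
have zx : 3%:R * enorm x <= 4%:R * enorm (x - y).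
  by have := enorm_sub_le x y; lra.
have z0 : 0 < enorm (x - y) by move: r0x; lra.
have ht : `|h (enorm x) - h (enorm y)| <= 1.
  by have := h01 (enorm x); have := h01 (enorm y); rewrite ler_norml; lra.
have tz : t <= 4%:R * tau * enorm (x - y).
  have : tau * (t / tau) <= tau * enorm x.
    by rewrite ler_pM2l//; move: r0x; rewrite /r0; lra.
  rewrite mulrCA divff ?gt_eqF// mulr1.
  have : tau * (3%:R * enorm x) <= tau * (4%:R * enorm (x - y)).
    by rewrite ler_pM2l.
  by lra.
have -> : 8%:R * tau * t = 4%:R * tau * t + 4%:R * tau * t by ring.
apply: enorm_perturb => //.
- rewrite dotZl normrM normrM (gtr0_norm t0) dotBr !(dotC e).
  have xe : `|dot x e - dot y e| <= 4%:R * tau * enorm (x - y).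
    have := cone x Ax; have := CauchySchwarz y e; rewrite e1 mulr1.
    have : M <= enorm x by have := ler_norm M; move: r0x; rewrite /r0; lra.
    move=> Mx ye /(_ Mx) xe; apply: le_trans (ler_normB _ _) _.
    have : tau * (3%:R * enorm x) <= tau * (4%:R * enorm (x - y)).
      by rewrite ler_pM2l.
    by have := enorm_ge0 y; lra.
  have -> : 4%:R * tau * t * enorm (x - y) = t * (4%:R * tau * enorm (x - y)).
    by ring.
  rewrite -mulrA ler_pM2l//; apply: le_trans xe.
  by rewrite ler_piMl.
- apply: (@le_trans _ _ (t * t)).
    rewrite -expr2 nq exprMn ler_piMr ?sqr_ge0//.
    by rewrite expr_le1.
  have -> : 4%:R * tau * t * enorm (x - y) = t * (4%:R * tau * enorm (x - y)).
    by ring.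
  by rewrite ler_pM2l.
Qed.

(** The component along [e] of an isometry approximating the slow translation
    gives a functional [w] bounded on [A], hence bounded by a constant [K] that
    does not depend on the length [t] of the translation; it cannot compensate
    for a translation with [t] large compared to [K]. *)
Lemma IAP_mu_large (R : realType) (n : nat) (A : set 'rV[R]_n) (c : R) :
  (1 <= n)%N -> unbounded A -> 0 < c -> IAP c A -> 1 / (17%:R * c) <= mu A.
Proof.
move=> n1 Aub c0 iap; rewrite leNgt; apply/negP; set tau := 1 / _ => mutau.
have tau0 : 0 < tau by rewrite divr_gt0// mulr_gt0.
have [e e1 [s stau se]] := mu_upper_bound n1 tau0 mutau.
have [M cone] := cone_condition stau se.
have [K hK] := uniform_functional_bound A 2%:R.
have [x0 Ax0 _] := unbounded_far 0 Aub.
(* The error [c * eps] is [8 / 17 * t], so the values [0] and [t] of the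
   displacement force [t <= 16 / 17 * t + 2 * K]. *)
pose t := 34%:R * `|K| + 1.
have t0 : 0 < t by have := normr_ge0 K; rewrite /t; lra.
have [h [h01 h0 [r1 h1] hnear]] :=
  slow_translation_nearisometry e1 tau0 t0 cone (enorm x0).
have [x1 Ax1 r1x1] := unbounded_far r1 Aub.
have eps0 : 0 <= 8%:R * tau * t.
  by apply: mulr_ge0 (ltW t0); apply: mulr_ge0 (ltW tau0).
have [T isoT hT] := IAP_bound iap eps0 hnear.
have ceps : c * (8%:R * tau * t) = 8%:R / 17%:R * t.
  by rewrite /tau; field; rewrite gt_eqF.
have [Q QQ TQ] := isometry_affine isoT.
pose w := e *m Q^T - e; pose b := dot (T 0) e.
have wb x : A x -> `|dot w x + b - t * h (enorm x)| <= 8%:R / 17%:R * t.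
  move=> Ax; rewrite -ceps; apply: le_trans (hT x Ax).
  rewrite -[leRHS]mulr1 -e1; apply: le_trans (CauchySchwarz _ _).
  rewrite TQ dotBl !(dotDl _ _ e) dotZl -(sqr_enorm e) e1 expr1n mulr1.
  rewrite {1}/w dotBl -/b dot_mulmx trmxK !(dotC e) opprD addrA.
  by rewrite (addrAC _ (- dot x e) b).
have w2 : enorm w <= 2%:R.
  apply: le_trans (enorm_triangleB _ _) _.
  have QtQ : Q^T *m Q^T^T = 1%:M by rewrite trmxK; exact: mulmx1C.
  by rewrite orthogonal_enorm// e1.
have wK : forall x, A x -> `|dot w x| <= K.
  apply: hK => //; exists (8%:R / 17%:R * t + `|b| + t) => x Ax.
  have /andP[hx0 hx1] := h01 (enorm x).
  have := wb x Ax; have := mulr_ge0 (ltW t0) hx0.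
  have : t * h (enorm x) <= t * 1 by rewrite ler_pM2l.
  have := ler_norm b; have := ler_norm (- b); rewrite normrN !ler_norml; lra.
have := wb _ Ax0; have := wb _ Ax1; have := wK _ Ax0; have := wK _ Ax1.
rewrite (h0 (enorm x0))// (h1 (enorm x1)) ?(ltW r1x1)//.
rewrite !ler_norml.
by have := ler_norm K; rewrite /t; lra.
Qed.

(** * Sharpness of the constant *)

Lemma enorm_le_coord (R : realType) (n : nat) (x : 'rV[R]_n) (d : R) :
  0 <= d -> (forall i, `|x 0 i| <= d) -> enorm x <= n%:R * d.
Proof.
move=> d0 xd; have [->|/enorm_gt0 x0] := eqVneq x 0.
  by rewrite enorm0 mulr_ge0.
rewrite -(ler_pM2r x0) -expr2 sqr_enorm /dot.
apply: (@le_trans _ _ (\sum_(i < n) d * enorm x)).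
  apply: ler_sum => i _; apply: le_trans (ler_norm _) _.
  by rewrite normrM ler_pM// coord_le_enorm.
by rewrite sumr_const card_ord -mulrA mulr_natl.
Qed.

Lemma rational_approximation (R : realType) (n : nat) (x : 'rV[R]_n) (d : R) :
  0 < d -> exists v : 'rV[rat]_n, enorm (map_mx ratr v - x) <= d.
Proof.
move=> d0; pose d' := d / n.+1%:R; have d'0 : 0 < d' by rewrite divr_gt0.
have /choice[v hv] (i : 'I_n) : exists q : rat, `|ratr q - x 0 i| <= d'.
  have /rat_in_itvoo[q /itvP qx] : x 0 i < x 0 i + d' by rewrite ltrDl.
  by exists q; rewrite ger0_norm ?subr_ge0 ?qx// lerBlDl ltW// qx.
exists (\row_i v i); apply: le_trans (enorm_le_coord (ltW d'0) _) _.
  by move=> i; rewrite !mxE.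
by rewrite /d' mulrCA ler_piMr ?(ltW d0)// ler_pdivrMr// mul1r ler_nat.
Qed.

Lemma normalize_close (R : realType) (n : nat) (v e : 'rV[R]_n) :
  enorm e = 1 -> v != 0 -> enorm ((enorm v)^-1 *: v - e) <= 2 * enorm (v - e).
Proof.
move=> e1 /enorm_gt0 v0.
have -> : (enorm v)^-1 *: v - e = ((enorm v)^-1 - 1) *: v + (v - e).
  by rewrite scalerBl scale1r addrA subrK.
apply: le_trans (enorm_triangle _ _) _; rewrite enormZ.
have -> : `|(enorm v)^-1 - 1| * enorm v = `|1 - enorm v|.
  by rewrite -{2}(gtr0_norm v0) -normrM mulrBl mulVf ?gt_eqF// mul1r.
rewrite -[X in X - _]e1.
have := enorm_sub_le e v; have := enorm_sub_le v e; rewrite (enorm_distC e).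
by move=> h1 h2; have : `|enorm e - enorm v| <= enorm (v - e);
  [rewrite ler_norml; lra|lra].
Qed.

Definition extremal (R : realType) (n : nat) (s : 'rV[R]_n * 'I_n * 'I_n) :=
  forall k, s.1.1 0 s.1.2 <= s.1.1 0 k <= s.1.1 0 s.2.

Lemma extremal_exists (R : realType) (n : nat) (v : 'rV[R]_n.+1) :
  exists a b, extremal (v, a, b).
Proof.
have [a _ amin] := @Order.TotalTheory.arg_minP _ _ _ (0 : 'I_n.+1) xpredT
  (v 0) isT.
have [b _ bmax] := @Order.TotalTheory.arg_maxP _ _ _ (0 : 'I_n.+1) xpredT
  (v 0) isT.
by exists a, b => k /=; rewrite amin//; exact: bmax.
Qed.

Lemma pickle_unbounded (T : countType) (t : nat -> T) (k : nat) :
  injective t -> exists j, (k <= pickle (t j))%N.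
Proof.
move=> tinj; apply: contrapT => /forallNP h.
have hk j : (pickle (t j) < k)%N by rewrite ltnNge; apply/negP.
have : injective (fun j : 'I_k.+1 => Ordinal (hk j)).
  move=> i j [] /(pcan_inj pickleK)/tinj ij; exact: val_inj.
by move/leq_card; rewrite !card_ord ltnn.
Qed.

(** Unit directions with a choice of a minimal and of a maximal coordinate,
    accumulating at every direction; the diagonal direction, all of whose
    coordinates are minimal and maximal, provides all the pairs [(i, i)]. *)
Lemma direction_sequence (R : realType) (n : nat) :
  exists s : nat -> 'rV[R]_n.+1 * 'I_n.+1 * 'I_n.+1,
  [/\ forall j, enorm (s j).1.1 = 1, forall j, extremal (s j),
    forall e, enorm e = 1 -> forall k, exists2 j, (k <= j)%N &
      enorm ((s j).1.1 - e) <= k.+1%:R^-1 &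
    forall i, exists j, (s j).1.2 = i /\ (s j).2 = i].
Proof.
(* The natural number in a code makes each direction occur infinitely often. *)
pose C := (nat * 'rV[rat]_n.+1 * 'I_n.+1 * 'I_n.+1)%type.
pose vec (c : C) : 'rV[R]_n.+1 := map_mx ratr c.1.1.2.
pose good (c : C) := vec c != 0 /\ extremal (vec c, c.1.2, c.2).
pose c0 i : C := (0%N, const_mx 1, i, i).
have vec0 i k : vec (c0 i) 0 k = 1 by rewrite !mxE rmorph1.
have good0 i : good (c0 i).
  split; last by move=> k /=; rewrite !vec0 lexx.
  by apply/eqP => /rowP/(_ 0)/eqP; rewrite vec0 mxE oner_eq0.
have /choice[g hg] (j : nat) : exists c, good c /\
    forall c', good c' -> pickle c' = j -> c' = c.
  have [[c' [gc' <-]]|h] := pselect (exists c, good c /\ pickle c = j).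
    by exists c'; split=> // c _ /(pcan_inj pickleK).
  by exists (c0 0); split=> // c gc cj; case: h; exists c.
have gE c : good c -> g (pickle c) = c.
  by move=> gc; have [_ /(_ c gc erefl)] := hg (pickle c).
exists (fun j => ((enorm (vec (g j)))^-1 *: vec (g j), (g j).1.2, (g j).2)).
split=> /= [j|j|e e1 k|i].
- by apply: enorm_normalize; have [[]] := hg j.
- have [[v0 ext] _] := hg j => k /=; rewrite !mxE.
  by rewrite !ler_pM2l ?invr_gt0 ?enorm_gt0//; have := ext k; rewrite !mxE.
- pose d : R := k.+1%:R^-1 / 2.
  have k0 : (0 : R) < k.+1%:R^-1 by rewrite invr_gt0.
  have k1 : k.+1%:R^-1 <= 1 :> R by rewrite invf_le1 ?ler1n.
  have d0 : 0 < d by rewrite divr_gt0.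
  have [v vd] := rational_approximation e d0.
  have [a [b ext]] := extremal_exists (map_mx ratr v : 'rV[R]_n.+1).
  have v0 : map_mx ratr v != 0 :> 'rV[R]_n.+1.
    apply: contraTneq vd => ->; rewrite sub0r enormN e1 -ltNge.
    by rewrite ltr_pdivrMr// mul1r (le_lt_trans k1)// ltr1n.
  have [|j kj] := @pickle_unbounded C (fun j => (j, v, a, b)) k.
    by move=> i j [].
  exists (pickle ((j, v, a, b) : C)) => //; rewrite gE//=.
  by apply: le_trans (normalize_close e1 v0) _; rewrite mulrC -ler_pdivlMr.
- by exists (pickle (c0 i)); rewrite gE.
Qed.

(** Otherwise the functional grows linearly along the points of the set that go
    to infinity in the direction of [w]. *)
Lemma bounded_functional_eq0 (R : realType) (n : nat) (A : set 'rV[R]_n)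
    (w : 'rV[R]_n) (C : R) :
  (forall e, enorm e = 1 -> cluster_directions A e) ->
  (forall x, A x -> `|dot w x| <= C) -> w = 0.
Proof.
move=> Afull wC; apply/eqP; apply: contrapT => /negP w0.
have nw0 := enorm_gt0 w0.
have /cluster_directionsP[_ h] := Afull _ (enorm_normalize w0).
pose k := (Num.truncn (2 * `|C| / enorm w)).+1.
have [x [Ax kx xw]] := h k.
have x0 : 0 < enorm x by apply: lt_le_trans kx; rewrite ltr0n.
have Ck : 2 * `|C| < k%:R * enorm w.
  by rewrite -ltr_pdivrMr// truncnS_gt.
have k2 : k.+1%:R^-1 <= 1 / 2 :> R.
  by rewrite div1r lef_pV2 ?posrE// ler_nat.
set u := (enorm w)^-1 *: w in xw.
have uw : dot u w = enorm w.
  by rewrite dotZl -sqr_enorm expr2 mulrA mulVf ?mul1r// gt_eqF.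
have h1 : enorm w / 2 <= dot ((enorm x)^-1 *: x) w.
  rewrite -[X in dot X _](subrK u) dotDl uw.
  have := CauchySchwarz ((enorm x)^-1 *: x - u) w.
  have : enorm ((enorm x)^-1 *: x - u) * enorm w <= 1 / 2 * enorm w.
    by rewrite ler_pM2r// (le_trans xw).
  by rewrite ler_norml; lra.
have h2 : enorm x * (enorm w / 2) <= dot x w.
  rewrite dotZl in h1; rewrite -(ler_pM2l x0) in h1.
  by rewrite mulVKf ?gt_eqF// in h1.
have h3 : k%:R * enorm w <= enorm x * enorm w by rewrite ler_pM2r.
have := wC x Ax; rewrite dotC; have := ler_norm (dot x w); have := ler_norm C.
by lra.
Qed.

(** The midpoint of two vertices of the regular simplex of edge length [2]
    whose vertices are the multiples by [sqrt 2] of the basis vectors. *)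
Definition displacement (R : realType) (n : nat) (a b : 'I_n) : 'rV[R]_n :=
  (Num.sqrt 2%:R / 2%:R) *: (delta_mx 0 a + delta_mx 0 b).

Lemma sqr_half_sqrt2 (R : realType) : (Num.sqrt 2%:R / 2%:R : R) ^+ 2 = 1 / 2.
Proof. by rewrite exprMn sqr_sqrtr ?ler0n//; field. Qed.

Lemma half_sqrt2_bounds (R : realType) : 0 < (Num.sqrt 2%:R / 2%:R : R) <= 1.
Proof.
have s0 : 0 < (Num.sqrt 2%:R / 2%:R : R) by rewrite divr_gt0 ?sqrtr_gt0.
rewrite s0/= -(@expr_le1 _ 2)// ?ltW// sqr_half_sqrt2; lra.
Qed.

Lemma enorm_displacement (R : realType) (n : nat) (a b : 'I_n) :
  enorm (displacement R a b) <= 2.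
Proof.
have /andP[s0 s1] := half_sqrt2_bounds R.
rewrite enormZ gtr0_norm//.
have := enorm_triangle (delta_mx 0 a : 'rV[R]_n) (delta_mx 0 b).
rewrite !enorm_delta; move: (enorm_ge0 (delta_mx 0 a + delta_mx 0 b : 'rV[R]_n)).
by nra.
Qed.

(** The projection of the simplex to any line has length at most [2], and the
    displacement attached to a direction [u] by an extremal pair is sent to the
    midpoint of this projection. *)
Lemma displacement_dot (R : realType) (n : nat) (u : 'rV[R]_n)
    (a b c d : 'I_n) : enorm u = 1 -> extremal (u, a, b) ->
  `|dot (displacement R a b - displacement R c d) u| <= 1.
Proof.
move=> u1 ext; have /andP[s0 _] := half_sqrt2_bounds R.
have /= /andP[ac cb] := ext c; have /= /andP[ad db] := ext d.
have sq : (u 0 b - u 0 a) ^+ 2 <= 2.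
  have [->|ab] := eqVneq a b; first by rewrite subrr expr0n.
  have : u 0 a ^+ 2 + u 0 b ^+ 2 <= 1.
    rewrite -[leRHS](expr1n _ 2) -u1 sqr_enorm /dot (bigD1 a)//=.
    rewrite (bigD1 b) 1?eq_sym//=.
    rewrite addrA -!expr2 lerDl; apply: sumr_ge0 => i _.
    by rewrite -expr2 sqr_ge0.
  by have := sqr_ge0 (u 0 a + u 0 b); nra.
rewrite dotBl !dotZl !dotDl !(dotC _ u) !dot_delta -mulrBr normrM gtr0_norm//.
apply: (@le_trans _ _ (Num.sqrt 2%:R / 2%:R * (u 0 b - u 0 a))).
  by rewrite ler_pM2l// ler_norml; lra.
have ba : 0 <= u 0 b - u 0 a by rewrite subr_ge0 (le_trans ac).
rewrite -(@expr_le1 _ 2) ?mulr_ge0 ?(ltW s0)//.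
rewrite exprMn sqr_half_sqrt2; lra.
Qed.

(** When the norms grow fast, the difference of two points is almost parallel to
    the farther one, so only the component along the direction of the latter of
    the relative displacement matters. *)
Lemma sparse_perturbation (R : realType) (n : nat) (N X Y : R)
    (u v p q : 'rV[R]_n) :
  1 <= N -> (32%:R * N + 1) * Y <= X -> 32%:R * N + 1 <= Y ->
  enorm u = 1 -> enorm v = 1 -> enorm p <= 2 -> enorm q <= 2 ->
  `|dot (p - q) u| <= 1 ->
  `|enorm ((X *: u + p) - (Y *: v + q)) - enorm (X *: u - Y *: v)| <= 1 + N^-1.
Proof.
move=> N1 YX NY u1 v1 p2 q2 pqu.
have Y0 : 0 < Y by lra.
have N0 : 0 < N by lra.
have NY0 : 0 <= N * Y by rewrite mulr_ge0 ?ltW.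
have NNY : N <= N * Y by rewrite ler_peMr ?ltW//; lra.
have X0 : 0 < X by lra.
have -> : (X *: u + p) - (Y *: v + q) = (X *: u - Y *: v) + (p - q).
  by rewrite opprD addrACA.
have z : X - Y <= enorm (X *: u - Y *: v).
  have := enorm_sub_le (X *: u) (Y *: v).
  by rewrite !enormZ u1 v1 !mulr1 !gtr0_norm.
have pq4 : enorm (p - q) <= 4%:R by have := enorm_triangleB p q; lra.
have N2 : 0 < (2 * N)^-1 by rewrite invr_gt0 mulr_gt0.
have NN : 2 * N * (2 * N)^-1 = 1 :> R by rewrite mulfV// gt_eqF// mulr_gt0.
have XY : 10%:R * N * Y + Y <= X - Y + Y by lra.
have -> : 1 + N^-1 = (1 + (2 * N)^-1) + (2 * N)^-1.
  by field; rewrite gt_eqF.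
have W : 32%:R * N <= X - Y by lra.
apply: enorm_perturb; first by lra.
- apply: (@le_trans _ _ (X + 4%:R * Y)).
    rewrite dotBr !dotZr; apply: le_trans (ler_normB _ _) _.
    rewrite !normrM (gtr0_norm X0) (gtr0_norm Y0).
    have : X * `|dot (p - q) u| <= X * 1 by rewrite ler_pM2l.
    have : Y * `|dot (p - q) v| <= Y * 4%:R.
      rewrite ler_pM2l//; apply: le_trans (CauchySchwarz _ _) _.
      by rewrite v1 mulr1.
    by lra.
  apply: (@le_trans _ _ ((1 + (2 * N)^-1) * (X - Y))); last first.
    by rewrite ler_pM2l//; lra.
  have : (2 * N)^-1 * (10%:R * N * Y) <= (2 * N)^-1 * (X - Y).
    by rewrite ler_pM2l//; lra.
  have -> : (2 * N)^-1 * (10%:R * N * Y) = 5%:R * Y.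
    by field; rewrite gt_eqF.
  by lra.
- apply: (@le_trans _ _ 16%:R).
    have -> : 16%:R = 4%:R ^+ 2 :> R by ring.
    by rewrite ler_sqr ?nnegrE ?enorm_ge0.
  have : (2 * N)^-1 * (32%:R * N) <= (2 * N)^-1 * enorm (X *: u - Y *: v).
    by rewrite ler_pM2l//; lra.
  have -> : (2 * N)^-1 * (32%:R * N) = 16%:R :> R by field; rewrite gt_eqF.
  by [].
Qed.

(** The mean of the squared distances from [b] to the vertices is smallest when
    [b] is the centroid, where it equals [2 - 2 / n.+1]. *)
Lemma simplex_radius (R : realType) (n : nat) (b : 'rV[R]_n.+1) (r : R) :
  (forall i, enorm (b - displacement R i i) <= r) ->
  2 - 2 / n.+1%:R <= r ^+ 2.
Proof.
move=> br; have n0 : 0 < n.+1%:R :> R by rewrite ltr0n.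
have r0 : 0 <= r by exact: le_trans (enorm_ge0 _) (br 0).
have dE i : displacement R i i = Num.sqrt 2%:R *: delta_mx 0 (i : 'I_n.+1).
  by rewrite /displacement scalerDr -scalerDl -splitr.
have s2 : (Num.sqrt 2%:R : R) ^+ 2 = 2 by rewrite sqr_sqrtr ?ler0n.
rewrite -(ler_pM2l n0).
apply: (@le_trans _ _ (\sum_(i < n.+1) (dot b b - 2 * Num.sqrt 2%:R * b 0 i + 2))).
  have nE c : \sum_(i < n.+1) c = n.+1%:R * c :> R.
    by rewrite sumr_const card_ord mulr_natl.
  rewrite big_split/= sumrB !nE {1}/dot mulr_sumr -sumrB.
  rewrite [leLHS]mulrBr [leLHS]addrC lerD2r -(nE (2 / n.+1%:R)) -sumrN.
  apply: ler_sum => i _; rewrite -(ler_pM2l n0).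
  have := sqr_ge0 (n.+1%:R * b 0 i - Num.sqrt 2%:R).
  have nV : n.+1%:R * (2 / n.+1%:R) = 2 :> R by rewrite mulrCA divff ?mulr1 ?gt_eqF.
  by rewrite sqrrB exprMn s2 mulrN nV; lra.
apply: (@le_trans _ _ (\sum_(i < n.+1) r ^+ 2)); last first.
  by rewrite sumr_const card_ord mulr_natl.
apply: ler_sum => i _.
have : enorm (b - displacement R i i) ^+ 2 <= r ^+ 2.
  by rewrite ler_sqr ?nnegrE ?enorm_ge0.
rewrite sqr_enormB dE dotZr dot_delta enormZ enorm_delta mulr1.
rewrite real_normK ?num_real// s2 sqr_enorm mulrA.
by [].
Qed.

(** On a set with every direction as a cluster direction, an isometry close to
    [x + p x] with bounded displacements [p x] has to be a translation: its
    linear part moves the points of the set by a bounded amount. *)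
Lemma near_translation (R : realType) (n : nat) (A : set 'rV[R]_n)
    (p T : 'rV[R]_n -> 'rV[R]_n) (B r : R) :
  (forall e, enorm e = 1 -> cluster_directions A e) -> isometry T ->
  (forall x, A x -> enorm (p x) <= B) ->
  (forall x, A x -> enorm (T x - (x + p x)) <= r) ->
  exists b, forall x, A x -> enorm (b - p x) <= r.
Proof.
move=> Afull isoT pB Tr; have [Q QQ TQ] := isometry_affine isoT.
suff fixQ x : A x -> x *m Q = x.
  exists (T 0) => x Ax; have := Tr x Ax.
  by rewrite TQ fixQ// opprD addrACA subrr add0r.
move=> Ax; apply/eqP; rewrite -subr_eq0; apply/eqP; apply: enorm0_eq0.
set e := x *m Q - x.
have w0 : e *m Q^T - e = 0.
  apply: (bounded_functional_eq0 (C := (r + enorm (T 0) + B) * enorm e) Afull).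
  move=> y Ay.
  have -> : dot (e *m Q^T - e) y = dot (y *m Q - y) e.
    by rewrite (dotBl (e *m Q^T)) (dotBl (y *m Q)) (dot_mulmx y) !(dotC y).
  apply: le_trans (CauchySchwarz _ _) _; apply: ler_wpM2r; first exact: enorm_ge0.
  have -> : y *m Q - y = (T y - (y + p y)) - T 0 + p y.
    by rewrite TQ opprD !addrA (addrAC _ (- T 0)) subrK (addrAC _ (- y)) addrK.
  apply: le_trans (enorm_triangle _ _) _; rewrite lerD ?pB//.
  by apply: le_trans (enorm_triangleB _ _) _; rewrite lerD2r Tr.
rewrite /enorm {1}/e dotBl dot_mulmx -dotBr w0 dot0r sqrtr0.
by [].
Qed.

(** The set consists of points [L ^+ j.+1 *: u_j] whose directions [u_j] are
    dense in the sphere, and the map displaces the [j]-th point by the midpoint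
    of the two vertices of a regular simplex that are extremal for [u_j].  All
    vertices occur as displacements, so the translation part of an isometry
    close to the map is the centre of a ball containing the simplex. *)
Lemma sqrt2_optimal (R : realType) (kappa : R) : kappa < Num.sqrt 2%:R ->
  exists (n : nat) (A : set 'rV[R]_n),
    [/\ (1 <= n)%N, unbounded A, 1 <= mu A & ~ IAP kappa A].
Proof.
move=> kappa2.
(* The errors are of order [1 / N], and [kappa ^+ 2 + 8 / N < 2] leaves room for
   them. *)
have [n n8] : exists n, 8%:R / (2 - kappa ^+ 2) < n.+1%:R.
  by exists (Num.truncn (8%:R / (2 - kappa ^+ 2))); exact: truncnS_gt.
have [N NE] : exists N : R, N = n.+1%:R by exists n.+1%:R.
have N1 : 1 <= N by rewrite NE ler1n.
have N0 : 0 < N by exact: lt_le_trans N1.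
have [s [s1 sext sdense svert]] := direction_sequence R n.
pose L : R := 32%:R * N + 1.
have L2 : 2 <= L by rewrite /L; lra.
have L0 : 0 < L by lra.
have L1 : 1 < L by lra.
pose pt j := L ^+ j.+1 *: (s j).1.1.
pose disp j := displacement R (s j).1.2 (s j).2.
have ptnorm j : enorm (pt j) = L ^+ j.+1.
  by rewrite enormZ s1 mulr1 ger0_norm// exprn_ge0// ltW.
have ptinj : injective pt.
  move=> i j /(congr1 (@enorm R n.+1)); rewrite !ptnorm.
  by move=> /(ieexprIn L0 (negbT (gt_eqF L1)))[].
have ptlarge j : j%:R <= enorm (pt j).
  rewrite ptnorm; apply: (@le_trans _ _ (2 ^+ j.+1)); last first.
    by rewrite lerXn2r ?nnegrE// ltW.
  by rewrite -natrX ler_nat ltnW// (ltn_trans _ (ltn_expl j.+1 _)).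
pose A := range pt.
pose idx x := xget 0%N [set j | pt j = x].
have idxE j : idx (pt j) = j.
  apply: ptinj; exact: (xgetPex 0%N (ex_intro [set k | pt k = pt j] j erefl)).
pose p x := disp (idx x).
have Afull e : enorm e = 1 -> cluster_directions A e.
  move=> e1; apply/cluster_directionsP; split=> // k.
  have [j kj je] := sdense e e1 k; exists (pt j); split; first by exists j.
    by apply: le_trans (ptlarge j); rewrite ler_nat.
  rewrite ptnorm scalerA mulVf ?scale1r// expf_neq0// gt_eqF//.
have Aub : unbounded A.
  move=> [M AM]; have := AM (pt (Num.truncn M).+1) (ex_intro2 _ _ _ I erefl).
  have := ptlarge (Num.truncn M).+1; have := truncnS_gt M; lra.
exists n.+1, A; split=> //; first exact: mu_full.
have near : nearisometry A (1 + N^-1) (fun x => x + p x).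
  suff H i j : (i < j)%N ->
      `|enorm ((pt j + disp j) - (pt i + disp i)) - enorm (pt j - pt i)|
      <= 1 + N^-1.
    have NV : 0 < N^-1 by rewrite invr_gt0.
    move=> _ _ [i _ <-] [j _ <-]; rewrite /p !idxE.
    have [ij|ji|->] := ltngtP i j.
    - have := H i j ij; rewrite (enorm_distC (pt j + disp j)).
      by rewrite (enorm_distC (pt j) (pt i)) ler_norml; lra.
    - by have := H j i ji; rewrite ler_norml; lra.
    - by rewrite !subrr enorm0; lra.
  move=> ij; apply: sparse_perturbation => //.
  - by rewrite -exprS ler_weXn2l// ltW.
  - by rewrite -[leLHS]expr1 ler_weXn2l// ltW.
  - exact: enorm_displacement.
  - exact: enorm_displacement.
  - apply: displacement_dot => //; have := sext j.
    by case: (s j) => [[]].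
move=> iap; have NV : 0 < N^-1 by rewrite invr_gt0.
have [|T isoT hT] := IAP_bound iap _ near; first by lra.
have [|b hb] := near_translation (B := 2) Afull isoT _ hT.
  by move=> x Ax; exact: enorm_displacement.
have hb' i : enorm (b - displacement R i i) <= kappa * (1 + N^-1).
  have [j [ja jb]] := svert i; have := hb (pt j) (ex_intro2 _ _ _ I erefl).
  by rewrite /p idxE /disp ja jb.
have k0 : 0 <= kappa.
  have := le_trans (enorm_ge0 _) (hb' 0).
  by rewrite pmulr_lge0//; lra.
have ksq : kappa ^+ 2 < 2.
  rewrite -[ltRHS](@sqr_sqrtr _ 2%:R) ?ler0n// ltr_pXn2r ?nnegrE ?sqrtr_ge0//.
have := simplex_radius hb'; rewrite -NE exprMn.
have NV1 : N^-1 <= 1 by rewrite invf_le1.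
have : 8%:R * N^-1 < 2 - kappa ^+ 2.
  rewrite mulrC -ltr_pdivlMl ?invr_gt0// invrK.
  have k2 : 0 < 2 - kappa ^+ 2 by lra.
  by rewrite -ltr_pdivrMr// NE.
set x := N^-1 in NV NV1 *; set k := kappa ^+ 2 in ksq *.
have kk : 0 <= k by exact: sqr_ge0.
move=> h1 h2.
have h3 : (1 + x) ^+ 2 <= 1 + 3%:R * x by nra.
have h4 : k * (1 + x) ^+ 2 <= k * (1 + 3%:R * x) by rewrite ler_wpM2l.
have h5 : k * x <= 2 * x by rewrite ler_wpM2r// ltW.
lra.
Qed.

Theorem mainTheorem1 (R : realType) :
  (forall (n : nat) (A : set 'rV[R]_n), (1 <= n)%N -> unbounded A ->
     (forall c : R, 0 < c -> IAP c A -> 1 / (17%:R * c) <= mu A) /\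
     (forall c' : R, 0 < c' -> 1 / c' <= mu A -> IAP (Num.sqrt 2%:R * c') A)) /\
  (forall kappa : R, kappa < Num.sqrt 2%:R ->
     ~ (forall (n : nat) (A : set 'rV[R]_n) (c' : R),
          (1 <= n)%N -> unbounded A -> 0 < c' -> 1 / c' <= mu A ->
          IAP (kappa * c') A)).
Proof.
split=> [n A n1 Aub|kappa kappa2 h].
  by split=> [c c0 iap|c' c0 muA]; [exact: IAP_mu_large|exact: mu_large_IAP].
have [n [A [n1 Aub muA nIAP]]] := sqrt2_optimal kappa2.
by apply: nIAP; rewrite -(mulr1 kappa); apply: h => //; rewrite divr1.
Qed.
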